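(* There is no orientable no-fold product structure, even or odd, with $|A|,|B|\ge 2$ and $\operatorname{girth}(L_1)\ge 8$. Equivalently, every orientable no-fold product structure, even or odd, with $|A|,|B|\ge 2$ has $\operatorname{girth}(L_1)\le 6$. In particular, no such structure satisfies $\operatorname{girth}(L_{AB})\ge 4$ and $\operatorname{girth}(L_1)\ge 8$, and none satisfies $\operatorname{girth}(L_{AB})\ge 3$ and $\operatorname{girth}(L_1)\ge 12$.
   Context: A product structure of type $(m,n)$ is a triple $\Pi=(A,B,P)$ with $A,B$ finite (disjoint) sets, $|A|=m$, $|B|=n$, and $P$ a partition of $A\times B$ into cells such that if two distinct positions $(a,b),(a',b')$ lie in the same cell then $a\ne a'$ and $b\ne b'$. It is even if every cell has size $2$, and odd if exactly one cell has size $1$ and all others have size $2$. Horizontal graphs: $L_A$ is the simple graph on $A$ in which $\{a,a'\}$ is an edge iff there are $b,b'\in B$ with $\{(a,b),(a',b')\}\in P$; $L_B$ is the simple graph on $B$ in which $\{b,b'\}$ is an edge iff there are $a,a'\in A$ with $\{(a,b),(a',b')\}\in P$. $L_{AB}=L_A\sqcup L_B$. Colors are the classes of the equivalence relation on $E(L_A)\sqcup E(L_B)$ generated by declaring, for each 2-cell $\{(a,b),(a',b')\}$, the edge $\{a,a'\}$ equivalent to the edge $\{b,b'\}$. A coherent orientation $O$ is a choice of one direction for each edge of $L_A$ and $L_B$ such that for every 2-cell $\{(a,b),(a',b')\}$ either $a\to a'$ and $b\to b'$, or $a'\to a$ and $b'\to b$. $(\Pi,O)$ is no-fold if no vertex has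 two distinct outgoing edges of the same color or two distinct incoming edges of the same color. An orientable no-fold product structure is one admitting a coherent orientation $O$ with $(\Pi,O)$ no-fold, considered together with any one such fixed $O$. Each color $c$ has two signed colors $(c,\mathrm{out}),(c,\mathrm{in})$. The middle link $L_1$ is the simple bipartite graph with parts $A\sqcup B$ and the set of signed colors, where $v$ is adjacent to $(c,\mathrm{out})$ iff $v$ is the tail of some edge of color $c$, and to $(c,\mathrm{in})$ iff $v$ is the head of some edge of color $c$. Girth is the length of a shortest cycle, $\infty$ for acyclic graphs. *)

(* Defs.v *)
From HB Require Import structures.
From mathcomp Require Import all_boot.

Set Implicit Arguments.
Unset Strict Implicit.
Unset Printing Implicit Defensive.

(* [option nat] serves as the naturals extended by [None] = infinity. *)
Definition enat_le (x y : option nat) : bool :=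
  match x, y with
  | _, None => true
  | None, Some _ => false
  | Some m, Some n => m <= n
  end.

(* A simple graph is a symmetric irreflexive [e : rel T].  A cycle of a simple
   graph has at least 3 vertices and repeats none, so its length lies in
   [3, #|T|]; the lengths are enumerated in increasing order. *)
Definition girth (T : finType) (e : rel T) : option nat :=
  ohead [seq k <- iota 3 #|T| | [exists c : k.-tuple T, ucycleb e c]].

Definition edge_set (T : finType) (e : rel T) : {set {set T}} :=
  [set [set x; y] | x in T, y in T & e x y].

(* The type (m, n) of the structure is (#|A|, #|B|). *)
Record product_structure (A B : finType) := ProductStructure {
  cells : {set {set A * B}};
  cells_partition : partition cells [set: A * B];
  cells_transverse : forall (C : {set A * B}) (p q : A * B),
    C \in cells -> p \in C -> q \in C -> p != q ->
    p.1 != q.1 /\ p.2 != q.2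
}.

Section ProductStructure.

Variables (A B : finType) (Pi : product_structure A B).

Definition is_even : Prop := forall C, C \in cells Pi -> #|C| = 2.

Definition is_odd : Prop :=
  exists2 C0, C0 \in cells Pi /\ #|C0| = 1 &
    forall C, C \in cells Pi -> C != C0 -> #|C| = 2.

(* [p != q] is needed: [set p; p] is a cell when p forms a cell of size 1. *)
Definition two_cell (p q : A * B) : bool :=
  (p != q) && ([set p; q] \in cells Pi).

Definition L_A : rel A :=
  fun a a' => [exists b, exists b', two_cell (a, b) (a', b')].

Definition L_B : rel B :=
  fun b b' => [exists a, exists a', two_cell (a, b) (a', b')].

Definition L_AB : rel (A + B) := fun x y =>
  match x, y with
  | inl a, inl a' => L_A a a'
  | inr b, inr b' => L_B b b'
  | _, _ => false
  end.

Definition edge_A (a a' : A) : {set A + B} := [set inl a; inl a'].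
Definition edge_B (b b' : B) : {set A + B} := [set inr b; inr b'].

Definition color_step : rel {set A + B} := fun e f =>
  [exists p : A * B, exists q : A * B, two_cell p q &&
    ((e == edge_A p.1 q.1) && (f == edge_B p.2 q.2) ||
     (e == edge_B p.2 q.2) && (f == edge_A p.1 q.1))].

(* [color_step] is symmetric, so [connect color_step] is the equivalence
   relation it generates. *)
Definition colors : {set {set {set A + B}}} :=
  equivalence_partition (connect color_step) (edge_set L_AB).

Definition color : finType := {c : {set {set A + B}} | c \in colors}.

(* [O x y] reads x -> y. *)
Definition is_orientation (O : rel (A + B)) : Prop :=
  (forall x y, O x y -> L_AB x y) /\
  (forall x y, L_AB x y -> O x y (+) O y x).

Definition is_coherent (O : rel (A + B)) : Prop :=
  forall a a' b b', two_cell (a, b) (a', b') ->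
    O (inl a) (inl a') /\ O (inr b) (inr b') \/
    O (inl a') (inl a) /\ O (inr b') (inr b).

Definition no_fold (O : rel (A + B)) : Prop :=
  forall (c : color) (v w w' : A + B),
    [set v; w] \in val c -> [set v; w'] \in val c ->
    (O v w -> O v w' -> w = w') /\ (O w v -> O w' v -> w = w').

(* (c, true) is the signed color (c, out), (c, false) is (c, in). *)
Definition signed_color : finType := (color * bool)%type.

Definition is_incident (O : rel (A + B)) (v : A + B) (s : signed_color) : bool :=
  if s.2 then [exists w, O v w && ([set v; w] \in val s.1)]
  else [exists w, O w v && ([set v; w] \in val s.1)].

Definition L_1 (O : rel (A + B)) : rel ((A + B) + signed_color) := fun x y =>
  match x, y with
  | inl v, inr s | inr s, inl v => is_incident O v s
  | _, _ => false
  end.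

End ProductStructure.

Arguments L_1 {A B} Pi O.

(* A product structure together with a fixed coherent no-fold orientation. *)
Record no_fold_structure (A B : finType) := NoFoldStructure {
  pstruct :> product_structure A B;
  orient : rel (A + B);
  orient_orientation : is_orientation pstruct orient;
  orient_coherent : is_coherent pstruct orient;
  orient_no_fold : no_fold pstruct orient
}.

(* Main.v *)
Require Import Defs.
From mathcomp Require Import all_boot.
From mathcomp Require Import zify.

(** Read [L_1] as an incidence geometry whose points are the vertices of
    [A + B] and whose lines are the signed colors.  Girth at least 8 forbids
    digons and triangles.  The partner of a position [(a, b)] puts [a] and [b]
    on a common line, so, with at most one exceptional pair, every point of [A]
    is collinear with every point of [B].

    If two points of [A] (or of [B]) lay on a line [l], the absence of triangles
    would force every point onto [l]; moving two points along the color of [l]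
    then gives two points which lie on both signed versions of that color, a
    digon.  So distinct points of [A], and of [B], are never collinear.
    Consequently, for a non-exceptional [a], sending [b] to the first coordinate
    of the partner of [(a, b)] is an injection of [B] into [A] minus [a]: hence
    [#|B| < #|A|], and by symmetry [#|A| < #|B|]. *)

Set Implicit Arguments.
Unset Strict Implicit.
Unset Printing Implicit Defensive.

(** * Girth bounds from explicit cycles *)

Lemma girth_le_cycle (T : finType) (e : rel T) (c : seq T) :
  3 <= size c -> ucycle e c -> enat_le (girth e) (Some (size c)).
Proof.
move=> c_ge3 ec; rewrite /girth; set s := [seq _ <- _ | _].
have c_s : size c \in s.
  rewrite mem_filter mem_iota c_ge3 /=; apply/andP; split.
    by apply/existsP; exists (in_tuple c).
  have /card_uniqP <- := ucycle_uniq ec.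
  by rewrite addSn ltnS (leq_trans (max_card _)) ?leq_addl.
have s_sorted : sorted ltn s.
  by apply: sorted_filter (iota_ltn_sorted _ _) => ? ? ?; apply: ltn_trans.
(* The lengths are listed in increasing order, so the head is at most every member. *)
case: s c_s s_sorted => [|h s] //=; rewrite inE => /predU1P[<- _|c_s].
  exact: leqnn.
move/(order_path_min (fun _ _ _ => @ltn_trans _ _ _))/allP/(_ _ c_s).
exact: ltnW.
Qed.

(** * Incidence geometries without digons or triangles *)

Definition no_digon_triangle (V S : finType) (inc : V -> S -> bool) : Prop :=
  (forall x y s t, inc x s -> inc y s -> inc x t -> inc y t ->
     x != y -> s = t) /\
  (forall x y z s t u, inc x s -> inc y s -> inc y t -> inc z t ->
     inc z u -> inc x u -> x != y -> y != z -> z != x ->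
     [|| s == t, t == u | u == s]).

Definition collinear (V S : finType) (inc : V -> S -> bool) (x y : V) : Prop :=
  exists2 s, inc x s & inc y s.

Lemma collinear_sym (V S : finType) (inc : V -> S -> bool) (x y : V) :
  collinear inc x y -> collinear inc y x.
Proof. by case=> s xs ys; exists s. Qed.

(** Two of the lines [l], [t], [s] along [xy], [yz], [xz] must coincide. If one of them is [l], then
    [z] lies on [l]; if [t = s], that line shares [x] and [y] with [l], so it is [l]. *)
Lemma mem_line_of_collinear (V S : finType) (inc : V -> S -> bool)
    (x y z : V) (l : S) :
  no_digon_triangle inc -> x != y -> inc x l -> inc y l ->
  z != x -> z != y -> collinear inc x z -> collinear inc y z -> inc z l.
Proof.
move=> [dig tri] xy xl yl zx zy [s xs zs] [t yt zt].
have yz : y != z by rewrite eq_sym.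
have /or3P[] := tri _ _ _ _ _ _ xl yl yt zt zs xs xy yz zx.
- by move/eqP->.
- by move/eqP=> ts; subst t; rewrite (dig _ _ _ _ xl yl xs yt xy).
- by move/eqP<-.
Qed.

Lemma two_points_avoiding (T : finType) (o : option T) :
  2 + isSome o <= #|T| ->
  exists x y : T, [/\ x != y, Some x != o & Some y != o].
Proof.
move=> cT; have /card_gt1P[x [y []]] : 1 < #|[set x | Some x != o]|.
  case: o cT => [z|] /= cT.
    have -> : [set x | Some x != Some z] = ~: [set z].
      by apply/setP=> x; rewrite !inE.
    by rewrite cardsC1; case: #|T| cT.
  have -> : [set x : T | Some x != None] = [set: T].
    by apply/setP=> x; rewrite !inE.
  by rewrite cardsT -[2]addn0.
by rewrite !inE => xo yo xy; exists x, y.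
Qed.

(** * Full lines when nearly all left-right pairs are collinear *)

Section Bipartite.
Context (A B S : finType) (inc : A + B -> S -> bool) (p0 : option (A * B)).
Context (spc : no_digon_triangle inc).
Context (colAB : forall a b, Some (a, b) != p0 ->
  collinear inc (inl a) (inr b)).

Lemma line_of_two_left (l : S) (a1 a2 : A) (b : B) :
  a1 != a2 -> inc (inl a1) l -> inc (inl a2) l ->
  Some (a1, b) != p0 -> Some (a2, b) != p0 -> inc (inr b) l.
Proof.
move=> a12 i1 i2 /colAB c1 /colAB c2.
exact: mem_line_of_collinear i1 i2 _ _ c1 c2.
Qed.

Lemma line_of_two_right (l : S) (b1 b2 : B) (a : A) :
  b1 != b2 -> inc (inr b1) l -> inc (inr b2) l ->
  Some (a, b1) != p0 -> Some (a, b2) != p0 -> inc (inl a) l.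
Proof.
move=> b12 i1 i2 /colAB/collinear_sym c1 /colAB/collinear_sym c2.
exact: mem_line_of_collinear i1 i2 _ _ c1 c2.
Qed.

(** The extra point reserved when [p0] is present leaves two points on each side that are not
    coordinates of the exceptional pair. *)
Context (cA : 2 + isSome p0 <= #|A|) (cB : 2 + isSome p0 <= #|B|).

Lemma two_left_avoiding : exists a1 a2 : A, a1 != a2 /\
  forall b, Some (a1, b) != p0 /\ Some (a2, b) != p0.
Proof.
have [|a1 [a2 [a12 h1 h2]]] := @two_points_avoiding A (omap fst p0).
  by case: p0 cA.
exists a1, a2; split=> // b.
by split; [apply: contraNN h1|apply: contraNN h2] => /eqP <-.
Qed.

Lemma two_right_avoiding : exists b1 b2 : B, b1 != b2 /\
  forall a, Some (a, b1) != p0 /\ Some (a, b2) != p0.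
Proof.
have [|b1 [b2 [b12 h1 h2]]] := @two_points_avoiding B (omap snd p0).
  by case: p0 cB.
exists b1, b2; split=> // a.
by split; [apply: contraNN h1|apply: contraNN h2] => /eqP <-.
Qed.

(** The line spreads in three rounds: to the left points that avoid [p0], from two of these to all
    of [B], and from two right points that avoid [p0] to all of [A]. *)
Lemma full_line_of_two_right (l : S) (b1 b2 : B) :
  b1 != b2 -> inc (inr b1) l -> inc (inr b2) l -> forall x, inc x l.
Proof.
move=> b12 i1 i2.
have [a1 [a2 [a12 ha]]] := two_left_avoiding.
have [b3 [b4 [b34 hb]]] := two_right_avoiding.
have leftl a : (forall b, Some (a, b) != p0) -> inc (inl a) l.
  by move=> h; apply: line_of_two_right b12 i1 i2 _ _.
have rightl b : inc (inr b) l.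
  have [h1 h2] := ha b.
  by apply: line_of_two_left a12 _ _ h1 h2; apply: leftl => b'; case: (ha b').
case=> // a; have [h3 h4] := hb a.
exact: line_of_two_right b34 _ _ h3 h4.
Qed.

Lemma full_line_of_two_left (l : S) (a1 a2 : A) :
  a1 != a2 -> inc (inl a1) l -> inc (inl a2) l -> forall x, inc x l.
Proof.
move=> a12 i1 i2; have [b3 [b4 [b34 hb]]] := two_right_avoiding.
apply: (full_line_of_two_right b34).
  by apply: line_of_two_left a12 i1 i2 _ _; case: (hb a1); case: (hb a2).
by apply: line_of_two_left a12 i1 i2 _ _; case: (hb a1); case: (hb a2).
Qed.

End Bipartite.

Lemma card_lt_of_injective_missing (T U : finType) (f : T -> U) (u : U) :
  injective f -> (forall x, f x != u) -> #|T| < #|U|.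
Proof.
move=> injf fu; rewrite -(card_imset predT injf) -[X in _ < X]cardsT.
apply/proper_card/properP; split; first exact: subsetT.
by exists u; rewrite ?inE //; apply/imsetP=> -[x _ /esym/eqP]; apply/negP.
Qed.

(** * Partners, parity and colors in a product structure *)

Section Structure.
Context (A B : finType) (Pi : product_structure A B).

Lemma two_cell_neq (p q : A * B) :
  two_cell Pi p q -> p.1 != q.1 /\ p.2 != q.2.
Proof.
by move=> /andP[pq C]; apply: (cells_transverse C) pq; rewrite !inE eqxx ?orbT.
Qed.

Lemma two_cell_of_card2 (p : A * B) :
  #|pblock (cells Pi) p| = 2 -> exists q, two_cell Pi p q.
Proof.
have /and3P[/eqP cov _ _] := cells_partition Pi.
have pcov : p \in cover (cells Pi) by rewrite cov inE.
have := pblock_mem pcov; have : p \in pblock (cells Pi) p by rewrite mem_pblock.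
move: (pblock _ _) => C pC CPi /eqP/cards2P[x [y [xy defC]]].
rewrite /two_cell; move: pC CPi; rewrite defC !inE => /orP[]/eqP-> CPi.
  by exists y; rewrite xy.
by exists x; rewrite eq_sym xy setUC.
Qed.

Lemma odd_card_of_is_odd : is_odd Pi -> odd (#|A| * #|B|).
Proof.
case=> C0 [C0Pi c0] c2; rewrite -card_prod -cardsT.
rewrite (card_partition (cells_partition Pi)) (bigD1 C0) //= c0.
rewrite (eq_bigr (fun=> 2)) => [|C /andP[CPi CC0]]; last exact: c2.
(* The total is 1 plus twice the number of the other cells. *)
by rewrite sum_nat_const; lia.
Qed.

Lemma partner_or_exception : is_even Pi \/ is_odd Pi ->
  2 <= #|A| -> 2 <= #|B| ->
  exists p0 : option (A * B),
    [/\ 2 + isSome p0 <= #|A|, 2 + isSome p0 <= #|B|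
      & forall p, Some p != p0 -> exists q, two_cell Pi p q].
Proof.
have /and3P[/eqP cov triv _] := cells_partition Pi.
have pcov p : p \in cover (cells Pi) by rewrite cov inE.
move=> eo A2 B2; case: eo => [ev|od].
  exists None; split=> // p _.
  by apply/two_cell_of_card2/ev/pblock_mem.
have := odd_card_of_is_odd od; rewrite oddM => /andP[oA oB].
case: od => C0 [C0Pi /eqP/cards1P[p0 defC0]] c2.
(* In the odd case both sides have odd size, so at least 3, which makes room for the exceptional
   position. *)
have gt2 n : 2 <= n -> odd n -> 2 < n by case: n => [|[|[|n]]].
exists (Some p0); split=> [||p pp0]; [exact: gt2|exact: gt2|].
apply/two_cell_of_card2/c2; first exact: pblock_mem.
apply: contraNneq pp0 => C0E.
have : p \in pblock (cells Pi) p by rewrite mem_pblock.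
by rewrite C0E defC0 inE => /eqP->.
Qed.

(** The color is the [connect]-class of [e]. Single steps suffice later, where both edges come from
    one 2-cell. *)
Lemma color_of_edge (e : {set A + B}) : e \in edge_set (L_AB Pi) ->
  exists c : color Pi, forall f, f \in edge_set (L_AB Pi) ->
    e = f \/ color_step Pi e f -> f \in val c.
Proof.
move=> eE.
pose c := [set f in edge_set (L_AB Pi) | connect (color_step Pi) e f].
have cP : c \in colors Pi by apply: imset_f.
exists (exist _ c cP) => f fE ef /=; rewrite inE fE /=.
by case: ef => [->|/connect1].
Qed.

Lemma edge_A_in (p q : A * B) : two_cell Pi p q ->
  [set inl p.1; inl q.1] \in edge_set (L_AB Pi).
Proof.
case: p q => [a b] [a' b'] pq; apply/imset2P.
exists (inl a) (inl a') => //; rewrite !inE /=.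
by apply/existsP; exists b; apply/existsP; exists b'.
Qed.

Lemma edge_B_in (p q : A * B) : two_cell Pi p q ->
  [set inr p.2; inr q.2] \in edge_set (L_AB Pi).
Proof.
case: p q => [a b] [a' b'] pq; apply/imset2P.
exists (inr b) (inr b') => //; rewrite !inE /=.
by apply/existsP; exists a; apply/existsP; exists a'.
Qed.

Lemma color_step_AB (p q : A * B) : two_cell Pi p q ->
  color_step Pi [set inl p.1; inl q.1] [set inr p.2; inr q.2].
Proof.
by move=> pq; apply/existsP; exists p; apply/existsP; exists q; rewrite pq !eqxx.
Qed.

Lemma color_step_BA (p q : A * B) : two_cell Pi p q ->
  color_step Pi [set inr p.2; inr q.2] [set inl p.1; inl q.1].
Proof.
move=> pq; apply/existsP; exists p; apply/existsP; exists q.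
by rewrite pq !eqxx orbT.
Qed.

End Structure.

(** * Signed colors as lines, and the girth bound *)

Section NoFold.
Context (A B : finType) (S : no_fold_structure A B).

Local Notation O := (orient S).
Local Notation inc := (@is_incident A B S O).

Lemma orient_asym (x y : A + B) : O x y -> O y x -> False.
Proof.
have [OL Ox] := orient_orientation S.
by move=> xy; have := Ox _ _ (OL _ _ xy); rewrite xy => /negP.
Qed.

Lemma incident_of_edge (x y : A + B) (c : color S) (d : bool) :
  [set x; y] \in val c -> (if d then O x y else O y x) -> inc x (c, d).
Proof. by case: d => xy o; apply/existsP; exists y; rewrite /= o xy. Qed.

Lemma coherent_dir (p q : A * B) (d : bool) : two_cell S p q ->
  (if d then O (inl p.1) (inl q.1) else O (inl q.1) (inl p.1)) <->
  (if d then O (inr p.2) (inr q.2) else O (inr q.2) (inr p.2)).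
Proof.
case: p q => [a b] [a' b'] pq.
by case: (orient_coherent pq) => -[oA oB]; case: d; split=> //= o;
  first [case: (orient_asym oA o) | case: (orient_asym oB o)].
Qed.

(** The signed color [s] depends only on the directed edge from [p.1] to [q.1]. Hence one [s] serves
    all 2-cells over that edge, and coherence carries its sign over to their edges in [B]. *)
Lemma common_line_A (p q : A * B) : two_cell S p q ->
  exists s, inc (inl p.1) s /\ forall p' q' : A * B,
    two_cell S p' q' -> p'.1 = p.1 -> q'.1 = q.1 -> inc (inr p'.2) s.
Proof.
move=> pq; have [c cP] := color_of_edge (edge_A_in pq).
have [d dP] : exists d : bool,
    if d then O (inl p.1) (inl q.1) else O (inl q.1) (inl p.1).
  case: p q pq {c cP} => [a b] [a' b'] /orient_coherent[[o _]|[o _]].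
    by exists true.
  by exists false.
exists (c, d); split.
  by apply: incident_of_edge dP; apply: cP (edge_A_in pq) _; left.
move=> p' q' pq' e1 e2; rewrite -e1 -e2 in cP dP.
apply: (@incident_of_edge _ (inr q'.2)); last exact/(coherent_dir d pq').
by apply: cP (edge_B_in pq') _; right; apply: color_step_AB.
Qed.

Lemma common_line_B (p q : A * B) : two_cell S p q ->
  exists s, inc (inr p.2) s /\ forall p' q' : A * B,
    two_cell S p' q' -> p'.2 = p.2 -> q'.2 = q.2 -> inc (inl p'.1) s.
Proof.
move=> pq; have [c cP] := color_of_edge (edge_B_in pq).
have [d dP] : exists d : bool,
    if d then O (inr p.2) (inr q.2) else O (inr q.2) (inr p.2).
  case: p q pq {c cP} => [a b] [a' b'] /orient_coherent[[_ o]|[_ o]].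
    by exists true.
  by exists false.
exists (c, d); split.
  by apply: incident_of_edge dP; apply: cP (edge_B_in pq) _; left.
move=> p' q' pq' e1 e2; rewrite -e1 -e2 in cP dP.
apply: (@incident_of_edge _ (inl q'.1)); last exact/(coherent_dir d pq').
by apply: cP (edge_A_in pq') _; right; apply: color_step_BA.
Qed.

Lemma incident_shift (x : A + B) (c : color S) (d : bool) : inc x (c, d) ->
  exists y, [/\ [set y; x] \in val c, (if d then O x y else O y x)
    & inc y (c, ~~ d)].
Proof.
case: d => /existsP[y /= /andP[o xy]]; exists y; rewrite setUC xy; split=> //;
  by apply/existsP; exists x; rewrite /= o setUC.
Qed.

Lemma no_full_line (s : signed_color S) : 2 <= #|{: A + B}| ->
  no_digon_triangle inc -> ~ forall x, inc x s.
Proof.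
case: s => c d /card_gt1P[x [y [_ _ xy]]] [dig _] full.
have [x' [cx ox ix]] := incident_shift (full x).
have [y' [cy oy iy]] := incident_shift (full y).
have xy' : x' != y'.
  (* Otherwise [x'] would have two edges of color [c] in the same direction, to [x] and to [y], a
     fold. *)
  apply: contraNneq xy => e; rewrite -e in cy oy.
  have [h1 h2] := orient_no_fold cx cy.
  by case: d ox oy {full ix iy} => ox oy; apply/eqP; auto.
(* [x'] and [y'] lie on both [(c, d)] and [(c, ~~ d)], which forces [d = ~~ d]. *)
by have [] := dig _ _ _ _ (full x') (full y') ix iy xy' => /eqP; case: (d).
Qed.

Lemma no_digon_triangle_of_girth :
  ~~ enat_le (girth (L_1 S O)) (Some 6) -> no_digon_triangle inc.
Proof.
move=> g6.
have no4 c : size c = 4 -> ~ ucycle (L_1 S O) c.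
  move=> c4 cyc; have := girth_le_cycle _ cyc; rewrite c4 => /(_ isT).
  move: g6; case: (girth _) => //= n n6 n4; case/negP: n6.
  exact: leq_trans n4 _.
have no6 c : size c = 6 -> ~ ucycle (L_1 S O) c.
  move=> c6 cyc; have := girth_le_cycle _ cyc; rewrite c6 => /(_ isT).
  exact/negP.
split=> [x y s t xs ys xt yt xy|x y z s t u xs ys yt zt zu xu xy yz zx].
  apply/eqP/negPn/negP=> st; apply: (no4 [:: inl x; inr s; inl y; inr t]) => //.
  rewrite /ucycle /= xs ys xt yt !inE /= !(inj_eq inl_inj) !(inj_eq inr_inj).
  by rewrite (negbTE xy) (negbTE st).
(* If the disjunction fails, three distinct lines alternate with three distinct points in a
   6-cycle. *)
rewrite -[_ || _]negbK !negb_or; apply/negP => /and3P[st tu us].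
apply: (no6 [:: inl x; inr s; inl y; inr t; inl z; inr u]) => //.
rewrite /ucycle /= xs ys yt zt zu xu !inE /= !(inj_eq inl_inj) !(inj_eq inr_inj).
by rewrite (negbTE xy) (negbTE yz) (negbTE st) (negbTE tu) (eq_sym x)
  (negbTE zx) (eq_sym s) (negbTE us).
Qed.

Lemma girth_L_1_le6 : is_even S \/ is_odd S -> 2 <= #|A| -> 2 <= #|B| ->
  enat_le (girth (L_1 S O)) (Some 6).
Proof.
move=> eo A2 B2; apply/negPn/negP => /no_digon_triangle_of_girth spc.
have [p0 [cA cB part]] := partner_or_exception eo A2 B2.
have colAB a b : Some (a, b) != p0 -> collinear inc (inl a) (inr b).
  move=> /part[q pq]; have [s [ls rs]] := common_line_A pq.
  by exists s => //; apply: (rs _ _ pq).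
have nofull s : ~ forall x, inc x s.
  by apply: no_full_line spc; rewrite card_sum; lia.
have BA : #|B| < #|A|.
  have [a [a' [_ ha]]] := two_left_avoiding cA.
  (* [f b] is a chosen partner of [(a, b)]. *)
  have [f fP] := fin_all_exists (fun b => part _ (ha b).1).
  apply: (@card_lt_of_injective_missing _ _ (fun b => (f b).1) a).
    move=> b1 b2 e; apply/eqP/negPn/negP => b12.
    (* If the partners of [(a, b1)] and [(a, b2)] agree in [A], both cells lie over the same edge,
       so [b1] and [b2] share the line [s], which is then full. *)
    have [s [_ sP]] := common_line_A (fP b1).
    apply: (nofull s); apply: (full_line_of_two_right spc colAB cA cB b12).
      exact: sP (fP b1) _ _.
    exact: sP (fP b2) _ (esym e).
  by move=> b; have [] := two_cell_neq (fP b); rewrite eq_sym.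
have AB : #|A| < #|B|.
  have [b [b' [_ hb]]] := two_right_avoiding cB.
  have [f fP] := fin_all_exists (fun a => part _ (hb a).1).
  apply: (@card_lt_of_injective_missing _ _ (fun a => (f a).2) b).
    move=> a1 a2 e; apply/eqP/negPn/negP => a12.
    have [s [_ sP]] := common_line_B (fP a1).
    apply: (nofull s); apply: (full_line_of_two_left spc colAB cA cB a12).
      exact: sP (fP a1) _ _.
    exact: sP (fP a2) _ (esym e).
  by move=> a; have [_] := two_cell_neq (fP a); rewrite eq_sym.
lia.
Qed.

End NoFold.

Theorem theoremA :
  (~ exists (A B : finType) (S : no_fold_structure A B),
      [/\ is_even S \/ is_odd S, 2 <= #|A|, 2 <= #|B|
        & enat_le (Some 8) (girth (L_1 S (orient S)))]) /\
  (forall (A B : finType) (S : no_fold_structure A B),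
      is_even S \/ is_odd S -> 2 <= #|A| -> 2 <= #|B| ->
      enat_le (girth (L_1 S (orient S))) (Some 6)) /\
  (~ exists (A B : finType) (S : no_fold_structure A B),
      [/\ is_even S \/ is_odd S, 2 <= #|A|, 2 <= #|B|,
          enat_le (Some 4) (girth (L_AB S))
        & enat_le (Some 8) (girth (L_1 S (orient S)))]) /\
  (~ exists (A B : finType) (S : no_fold_structure A B),
      [/\ is_even S \/ is_odd S, 2 <= #|A|, 2 <= #|B|,
          enat_le (Some 3) (girth (L_AB S))
        & enat_le (Some 12) (girth (L_1 S (orient S)))]).
Proof.
(* This covers infinite girth too, since [None] is not at most [Some 6]. *)
have absurd6 k g : 6 < k -> enat_le (Some k) g -> enat_le g (Some 6) -> False.
  by case: g => //= n; lia.
split=> [[A [B [S [eo A2 B2 g]]]]|].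
  exact: absurd6 g (girth_L_1_le6 eo A2 B2).
split=> [A B S|]; first exact: girth_L_1_le6.
split=> -[A [B [S [eo A2 B2 _ g]]]];
  exact: absurd6 g (girth_L_1_le6 eo A2 B2).
Qed.
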